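(* Let $q\in(0,1)$, $n\ge 1$, and let $a,b\in\mathbb{R}$ range over the set $0<aq<1$, $bq<1$. For such parameters the little $q$-Jacobi polynomial $p_n(x;a,b)$ has $n$ real simple zeros in $(0,1)$; denote them by $\lambda_1(a,b)<\dots<\lambda_n(a,b)$. Then for every $k=1,\dots,n$: - for each fixed $a\in(0,1/q)$, the function $b\mapsto\lambda_k(a,b)$ is strictly increasing on $(-\infty,1/q)$; - for each fixed $b\in(-\infty,1/q)$, the function $a\mapsto \lambda_k(a,b)$ is strictly decreasing on $(0,1/q)$.
   Context: For $c\in\mathbb{C}$ and an integer $j\ge0$, $(c;q)_0:=1$ and $(c;q)_j:=\prod_{i=0}^{j-1}(1-cq^i)$. The little $q$-Jacobi polynomial of degree $n$ with parameters $a,b$ is $$p_n(x;a,b)=p_n(x;a,b|q):=\sum_{j=0}^n\frac{(q^{-n};q)_j\,(abq^{n+1};q)_j}{(aq;q)_j\,(q;q)_j}\,(qx)^j .$$ For $0<aq<1$ and $bq<1$ these polynomials are orthogonal with respect to the discrete measure $\sum_{k\ge0}\frac{(bq;q)_k}{(q;q)_k}(aq)^k\delta_{q^k}$, where $\delta_y$ is the unit point mass at $y$; in particular, $p_n(x;a,b)$ has $n$ real simple zeros, all in $(0,1)$ (a known fact). *)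

(* Defs.v *)
From mathcomp Require Import all_boot all_order all_algebra.
From mathcomp Require Import polyrcf reals.

Set Implicit Arguments.
Unset Strict Implicit.
Unset Printing Implicit Defensive.

Import Order.TTheory GRing.Theory Num.Theory.
Local Open Scope ring_scope.

Definition qpochhammer (F : fieldType) (c q : F) (j : nat) : F :=
  \prod_(i < j) (1 - c * q ^+ i).

Definition little_qjacobi (F : fieldType) (q : F) (n : nat) (a b : F) :
    {poly F} :=
  \sum_(j < n.+1)
    (qpochhammer (q ^- n) q j * qpochhammer (a * b * q ^+ n.+1) q j /
     (qpochhammer (a * q) q j * qpochhammer q q j)) *: (q *: 'X) ^+ j.

(* [roots p 0 1] is the strictly increasing list of the distinct roots of p in
   the open interval (0, 1). *)
Definition little_qjacobi_zeros (R : realType) (q : R) (n : nat) (a b : R) :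
    seq R :=
  roots (little_qjacobi q n a b) 0 1.

(* Indices start at 0: this is $\lambda_{k+1}(a, b)$.  The default value of
   [nth] is irrelevant as soon as there are n zeros and k < n. *)
Definition little_qjacobi_zero (R : realType) (q : R) (n : nat) (k : nat)
    (a b : R) : R :=
  nth 0 (little_qjacobi_zeros q n a b) k.

(* Main.v *)
From HB Require Import structures.
Require Import Defs.
From mathcomp Require Import all_boot all_order all_algebra.
From mathcomp Require Import polyrcf reals ring lra.
From mathcomp Require Import boolp classical_sets topology normedtype sequences.

Set Implicit Arguments.
Unset Strict Implicit.
Unset Printing Implicit Defensive.

Import Order.TTheory GRing.Theory Num.Theory.
Import numFieldNormedType.Exports.
Local Open Scope classical_set_scope.
Local Open Scope ring_scope.

(** The monotonicity is a global, derivative-free form of Markov's theorem on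
the zeros of orthogonal polynomials.

Let L1 and L2 be the linear functionals of two of the discrete measures,
sum_k w1_k delta_{q^k} and sum_k w2_k delta_{q^k}, and suppose that w2_k/w1_k
is strictly decreasing in k, that is, increasing as a function of the node q^k.
Passing from b1 to b2 > b1, or from a1 to a2 < a1, has this effect on the
weights.  For t > 0 let c be the value of w2/w1 at the largest node not
exceeding t.  Then (w2_k - c w1_k) (q^k - t) >= 0 at every node, with equality
at one node at most, so
  L2((X - t) p^2) > c L1((X - t) p^2)   for every nonzero polynomial p
(qgrid_functional_dominates).

Let lambda_0 < ... < lambda_(n-1) and mu_0 < ... < mu_(n-1) be the zeros of the
two orthogonal polynomials, and suppose mu_k <= lambda_k.  Take t = lambda_k
and let p be the product of the factors X - lambda_j for j < k and X - mu_j for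
j > k.  Gauss quadrature is exact and has positive weights in degree < 2n, the
degree of (X - t) p^2 being 2n - 1.  Evaluated at the lambda_j, where
(X - t) p^2 vanishes for j <= k and is nonnegative for j > k, it gives
L1((X - t) p^2) >= 0; evaluated at the mu_j, where (X - t) p^2 vanishes for
j > k and is nonpositive for j <= k, it gives L2((X - t) p^2) <= 0.  This
contradicts the displayed inequality; hence lambda_k < mu_k
(markov_zeros_lt).

It remains to see that the little q-Jacobi polynomials are orthogonal with
respect to these measures and have n simple zeros in (0, 1).  Orthogonality
only involves the moments, whose two-term recurrence (qgrid_moments_lqj_weight)
comes from telescoping the relation between consecutive weights.  This
recurrence makes the q-difference operator of the polynomials symmetric, and
eigenfunctions for distinct eigenvalues are orthogonal
(little_qjacobi_orthogonal).  The zeros are then located by the usual count of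
sign changes (orthogonal_roots). *)

(** * Linear functionals given by moments *)

(** Integration against a measure with moments mu.  Defining it by the moments
makes it linear for every mu, without any convergence condition, and keeps the
orthogonality purely algebraic. *)
Definition moment_functional (R : comNzRingType) (mu : nat -> R)
  (p : {poly R}) : R := \sum_(i < size p) p`_i * mu i.

Lemma moment_functional_wide (R : comNzRingType) (mu : nat -> R) m
    (p : {poly R}) : (size p <= m)%N ->
  moment_functional mu p = \sum_(i < m) p`_i * mu i.
Proof.
move=> pm; rewrite /moment_functional (big_ord_widen m (fun i => p`_i * mu i))//.
rewrite big_mkcond; apply: eq_bigr => i _.
by case: ltnP => // /leq_sizeP/(_ i (leqnn _)) ->; rewrite mul0r.
Qed.

Lemma moment_functional_scalar (R : comNzRingType) (mu : nat -> R) :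
  scalar (moment_functional mu).
Proof.
move=> a p r; set m := maxn (size p) (size r).
have pm : (size p <= m)%N by rewrite leq_maxl.
have rm : (size r <= m)%N by rewrite leq_maxr.
have apm : (size (a *: p + r)%R <= m)%N.
  rewrite (leq_trans (size_polyD _ _))// geq_max rm andbT.
  exact: leq_trans (size_scale_leq _ _) pm.
rewrite !(@moment_functional_wide _ _ m)// mulr_sumr -big_split.
by apply: eq_bigr => i _; rewrite coefD coefZ mulrDl mulrA.
Qed.

HB.instance Definition _ (R : comNzRingType) (mu : nat -> R) :=
  GRing.isLinear.Build R {poly R} R *%R (moment_functional mu)
    (moment_functional_scalar mu).

Lemma moment_functionalXn (R : comNzRingType) (mu : nat -> R) m :
  moment_functional mu 'X^m = mu m.
Proof.
rewrite (@moment_functional_wide _ _ m.+1) ?size_polyXn//.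
rewrite (bigD1 ord_max)//= coefXn eqxx mul1r big1 ?addr0// => i.
by rewrite -val_eqE/= coefXn => /negPf ->; rewrite mul0r.
Qed.

(** * Gauss quadrature and comparison of zeros *)

Definition prod_roots (R : comNzRingType) (s : seq R) : {poly R} :=
  \prod_(x <- s) ('X - x%:P).

Definition orthogonal_to_lower (R : comNzRingType) (L : {scalar {poly R}}) (n : nat)
  (p : {poly R}) := forall r : {poly R}, (size r <= n)%N -> L (p * r) = 0.

Lemma size_prod_roots (R : comNzRingType) (s : seq R) :
  size (prod_roots s) = (size s).+1.
Proof. exact: size_prod_XsubC. Qed.

Lemma horner_prod_roots0 (R : idomainType) (s : seq R) x :
  ((prod_roots s).[x] == 0) = (x \in s).
Proof. by rewrite -rootE root_prod_XsubC. Qed.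

(** Gauss quadrature, reduced to the positivity of its weights.  With l_x
the product of the factors X - y over the nodes y <> x, the combination
u = sum_x (h(x) / l_x(x)^2) l_x^2 agrees with h on all nodes, so h - u is a
multiple of the orthogonal polynomial by a polynomial of lower degree, and
L h = L u.  Interpolating by the squares l_x^2 rather than by the l_x makes the
sign of L u visible. *)
Lemma quadrature_ge0 (R : realFieldType) (L : {scalar {poly R}}) (s : seq R)
    (h : {poly R}) :
  uniq s -> orthogonal_to_lower L (size s) (prod_roots s) ->
  (forall l, 0 <= L (l ^+ 2)) ->
  (size h <= (size s).*2)%N -> (forall x, x \in s -> 0 <= h.[x]) -> 0 <= L h.
Proof.
move=> us orth Lsq hs h0.
pose l x := prod_roots (rem x s).
have lx x : x \in s -> (l x).[x] != 0.
  by move=> xs; rewrite horner_prod_roots0 mem_rem_uniqF.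
pose u := \sum_(x <- s) (h.[x] / (l x).[x] ^+ 2) *: (l x) ^+ 2.
have u0 : 0 <= L u.
  rewrite /u linear_sum big_seq sumr_ge0//= => x xs.
  by rewrite linearZ/= mulr_ge0// divr_ge0 ?h0 ?sqr_ge0.
have su : (size u <= (size s).*2)%N.
  rewrite /u big_seq; elim/big_ind: _ => [|p r hp hr|x xs].
  - by rewrite size_poly0.
  - by rewrite (leq_trans (size_polyD _ _))// geq_max hp hr.
  rewrite (leq_trans (size_scale_leq _ _))//.
  rewrite (leq_trans (size_poly_exp_leq _ _))// size_prod_roots/= size_rem//.
  by case: s xs {us orth hs h0 l lx u u0} => //= y s _; rewrite muln2 ltn_double.
have /dvdpP[r hr] : prod_roots s %| h - u.
  apply: uniq_roots_dvdp; last by rewrite uniq_rootsE.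
  apply/allP => x xs; rewrite rootE hornerD hornerN subr_eq0 /u horner_sum.
  rewrite (bigD1_seq x)//= hornerZ horner_exp divfK ?expf_neq0 ?lx//.
  rewrite big1_seq ?addr0// => y /andP[yx ys].
  rewrite hornerZ horner_exp; suff -> : (l y).[x] = 0 by rewrite expr0n mulr0.
  by apply/eqP; rewrite horner_prod_roots0 mem_rem_uniq// inE eq_sym yx xs.
have -> : h = u + prod_roots s * r by rewrite mulrC -hr addrC subrK.
rewrite linearD/= orth ?addr0//.
have [->|r0] := eqVneq r 0; first by rewrite size_poly0.
have P0 : prod_roots s != 0 by rewrite -size_poly_eq0 size_prod_roots.
have : (size (h - u)%R <= (size s).*2)%N.
  by rewrite (leq_trans (size_polyD _ _))// geq_max hs size_polyN.
by rewrite hr size_mul// size_prod_roots addnS/= -addnn leq_add2r.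
Qed.

(** The comparison of zeros explained at the top, for an abstract pair of
functionals; the domination at t = s1_k alone decides the position of s2_k. *)
Lemma markov_zeros_lt (R : realFieldType) (L1 L2 : {scalar {poly R}})
    (s1 s2 : seq R) (k : nat) (c : R) :
  sorted <%R s1 -> sorted <%R s2 -> size s1 = size s2 -> (k < size s1)%N ->
  orthogonal_to_lower L1 (size s1) (prod_roots s1) ->
  orthogonal_to_lower L2 (size s2) (prod_roots s2) ->
  (forall l, 0 <= L1 (l ^+ 2)) -> (forall l, 0 <= L2 (l ^+ 2)) ->
  0 <= c ->
  (forall p, p != 0 -> c * L1 (('X - (s1`_k)%:P) * p ^+ 2) <
                       L2 (('X - (s1`_k)%:P) * p ^+ 2)) ->
  s1`_k < s2`_k.
Proof.
move=> ss1 ss2 es ks1 o1 o2 sq1 sq2 c0 dom; rewrite ltNge; apply/negP => le21.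
have ks2 : (k < size s2)%N by rewrite -es.
have u1 : uniq s1 by exact: lt_sorted_uniq.
have u2 : uniq s2 by exact: lt_sorted_uniq.
(* This p has degree n - 1 and is chosen so that (X - s1_k) p^2 vanishes at the
   s1_j with j <= k and at the s2_j with j > k. *)
pose p := prod_roots (take k s1) * prod_roots (drop k.+1 s2).
have p0 : p != 0.
  by rewrite mulf_neq0// -size_poly_eq0 size_prod_roots.
have sp : size p = size s1.
  rewrite size_mul -?size_poly_eq0 ?size_prod_roots//.
  rewrite size_drop size_takel ?(ltnW ks1)// -es addSn/= addnS -addSn.
  by rewrite subnKC.
set g := ('X - (s1`_k)%:P) * p ^+ 2.
have sg : (size g <= (size s1).*2)%N.
  rewrite size_mul ?polyXsubC_eq0 ?expf_neq0// size_XsubC/=.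
  have := size_poly_exp_leq p 2; rewrite sp => /leq_ltn_trans; apply.
  by case: (s1) ks1 => //= x s _; rewrite muln2.
have hg x : g.[x] = (x - s1`_k) * p.[x] ^+ 2 by rewrite !hornerE.
have L1g : 0 <= L1 g.
  apply: (quadrature_ge0 u1) => // x /(nthP 0)[j js <-]; rewrite hg.
  have [jk|kj] := ltnP j k.
    suff -> : p.[s1`_j] = 0 by rewrite expr0n mulr0.
    apply/eqP; rewrite hornerM mulf_eq0 horner_prod_roots0 -(nth_take _ jk).
    by rewrite mem_nth// size_takel// ltnW.
  rewrite mulr_ge0 ?sqr_ge0// subr_ge0.
  by rewrite lt_sorted_leq_nth.
have L2g : 0 <= L2 (- g).
  apply: (quadrature_ge0 u2) => //; first by rewrite size_polyN -es.
  move=> x /(nthP 0)[j js <-]; rewrite hornerN hg -mulNr opprB.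
  have [jk|kj] := leqP j k.
    rewrite mulr_ge0 ?sqr_ge0// subr_ge0 (le_trans _ le21)//.
    by rewrite lt_sorted_leq_nth.
  suff -> : p.[s2`_j] = 0 by rewrite expr0n mulr0.
  apply/eqP; rewrite hornerM mulf_eq0 !horner_prod_roots0 orbC -(subnKC kj).
  by rewrite -nth_drop mem_nth// size_drop ltn_sub2r// (leq_ltn_trans kj).
have := dom p p0; rewrite -/g ltNge => /negP; apply.
by apply: le_trans (mulr_ge0 c0 L1g); rewrite -oppr_ge0 -linearN.
Qed.

(** * Zeros of orthogonal polynomials in the unit interval *)

(** Multiplying p by its value at 1/2 makes it nonnegative: a negative value
would yield a zero between that point and 1/2. *)
Lemma noroot_constant_sign (R : rcfType) (p : {poly R}) :
  (forall x, 0 < x < 1 -> ~~ root p x) ->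
  exists e : R, e != 0 /\ forall x, 0 <= x <= 1 -> 0 <= (e *: p).[x].
Proof.
move=> nr; pose h : R := 2^-1; have h01 : 0 < h < 1 by rewrite /h; lra.
exists (p.[h]); split; first exact: nr.
move=> x x01; rewrite hornerZ leNgt; apply/negP => neg.
have noIVT y : (y \in `]x, h[) \/ (y \in `]h, x[) -> ~~ root p y.
  by rewrite !in_itv/= => yxh; apply: nr; lra.
have [xh|hx] := leP x h.
  have [|y yxh ry] := poly_ivtoo xh (p := p); first by rewrite mulrC.
  by have := noIVT y (or_introl yxh); rewrite ry.
have [//|y yhx ry] := poly_ivtoo (ltW hx) (p := p).
by have := noIVT y (or_intror yhx); rewrite ry.
Qed.

(** The sequence s lists the zeros of odd multiplicity in (0, 1).  Removing
one factor X - r from p toggles the membership of r in s, which gives an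
induction on the degree that does not mention multiplicities. *)
Lemma sign_changes (R : rcfType) (p : {poly R}) : p != 0 ->
  exists s : seq R, [/\ uniq s, forall x, x \in s -> 0 < x < 1,
    prod_roots s %| p &
    exists e : R, e != 0 /\ forall x, 0 <= x <= 1 -> 0 <= (e *: (p * prod_roots s)).[x]].
Proof.
have [m] := ubnP (size p); elim: m => // m IH in p * => /ltnSE sp p0.
case Er: (roots p 0 1) => [|r rs].
  exists [::]; split=> //; first by rewrite /prod_roots big_nil dvd1p.
  rewrite /prod_roots big_nil mulr1; apply: noroot_constant_sign => x x01.
  by apply/negP => rx; have := in_roots p 0 1 x; rewrite Er in_itv/= rx x01 p0.
have : r \in roots p 0 1 by rewrite Er mem_head.
rewrite in_roots in_itv/= => /and3P[/factor_theorem[p1 p1E] r01 _].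
have p10 : p1 != 0 by apply: contraNneq p0 => p10; rewrite p1E p10 mul0r.
have [|s [us s01 sp1 [e [e0 he]]]] := IH p1 _ p10.
  by rewrite (leq_trans _ sp)// p1E size_Mmonic ?monicXsubC// size_XsubC addn2.
have [rs'|rs'] := boolP (r \in s).
  have sE : prod_roots s = ('X - r%:P) * prod_roots (rem r s).
    by rewrite /prod_roots (big_rem r).
  exists (rem r s); split; first exact: rem_uniq.
  - by move=> x /mem_rem/s01.
  - by rewrite p1E dvdp_mulr// (dvdp_trans _ sp1)// sE dvdp_mull.
  - by exists e; split => // x /he; rewrite p1E -mulrA -sE.
have sE : prod_roots (r :: s) = ('X - r%:P) * prod_roots s.
  by rewrite /prod_roots big_cons.
exists (r :: s); split; first by rewrite /= rs'.
- by move=> x; rewrite inE => /predU1P[->//|/s01].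
- by rewrite p1E sE mulrC dvdp_mul.
exists e; split => // x /he; rewrite p1E sE => ge0.
have -> : e *: (p1 * ('X - r%:P) * (('X - r%:P) * prod_roots s)) =
          ('X - r%:P) ^+ 2 * (e *: (p1 * prod_roots s)).
  by rewrite -!mul_polyC; ring.
by rewrite hornerM mulr_ge0// horner_exp sqr_ge0.
Qed.

(** The closed interval is used because the largest node q^0 = 1 of the
discrete measures is an endpoint. *)
Definition positive_on_unit_interval (R : realFieldType) (L : {scalar {poly R}}) :=
  forall h : {poly R}, h != 0 -> (forall x, 0 <= x <= 1 -> 0 <= h.[x]) -> 0 < L h.

Lemma positive_sqr_ge0 (R : realFieldType) (L : {scalar {poly R}}) :
  positive_on_unit_interval L -> forall l, 0 <= L (l ^+ 2).
Proof.
move=> posL l; have [->|l0] := eqVneq l 0; first by rewrite expr0n linear0.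
by apply/ltW/posL; rewrite ?expf_neq0// => x _; rewrite horner_exp sqr_ge0.
Qed.

(** If p changed sign at fewer than n points of (0, 1), its product with the
polynomial vanishing at these points would have constant sign, whereas L
annihilates this product by orthogonality. *)
Lemma orthogonal_roots (R : rcfType) (L : {scalar {poly R}}) n (p : {poly R}) :
  positive_on_unit_interval L -> p != 0 -> (size p <= n.+1)%N ->
  orthogonal_to_lower L n p ->
  size (roots p 0 1) = n /\ p = lead_coef p *: prod_roots (roots p 0 1).
Proof.
move=> posL p0 sp orth.
have [s [us s01 sdvd [e [e0 he]]]] := sign_changes p0.
have P0 t : prod_roots t != 0 :> {poly R}.
  by rewrite -size_poly_eq0 size_prod_roots.
have ns : (n <= size s)%N.
  rewrite leqNgt; apply/negP => sn.
  suff : 0 < L (e *: (p * prod_roots s)).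
    by rewrite linearZ/= orth ?size_prod_roots// mulr0 ltxx.
  by apply: posL => //; rewrite scaler_eq0 (negPf e0)/= mulf_neq0.
have ssub : {subset s <= roots p 0 1}.
  move=> x xs; rewrite in_roots in_itv/= s01// p0 andbT andbT.
  by rewrite -dvdp_XsubCl (dvdp_trans _ sdvd)// dvdp_XsubCl root_prod_XsubC.
have sz : (size (roots p 0 1) < size p)%N.
  apply: max_poly_roots => //; last exact: uniq_roots.
  by apply/allP => x /root_roots.
have szr : size (roots p 0 1) = n.
  apply/eqP; rewrite eqn_leq -ltnS (leq_trans sz sp)/=.
  by rewrite (leq_trans ns)// uniq_leq_size.
have spn : size p = n.+1 by apply/eqP; rewrite eqn_leq sp -szr sz.
split => //; rewrite /prod_roots; apply: all_roots_prod_XsubC.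
- by rewrite spn szr.
- by apply/allP => x /root_roots.
- by rewrite uniq_rootsE uniq_roots.
Qed.

(** * Orthogonality of the little q-Jacobi polynomials *)

Lemma qpochhammerS (F : fieldType) (c q : F) j :
  qpochhammer c q j.+1 = qpochhammer c q j * (1 - c * q ^+ j).
Proof. by rewrite /qpochhammer big_ord_recr. Qed.

Lemma qpochhammer_neq0 (F : fieldType) (c q : F) j :
  (forall i, (i < j)%N -> 1 - c * q ^+ i != 0) -> qpochhammer c q j != 0.
Proof. by move=> nz; apply/prodf_neq0 => i _; apply: nz. Qed.

Definition lqj_coef (F : fieldType) (q : F) (n : nat) (a b : F) (j : nat) : F :=
  qpochhammer (q ^- n) q j * qpochhammer (a * b * q ^+ n.+1) q j /
  (qpochhammer (a * q) q j * qpochhammer q q j) * q ^+ j.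

Lemma little_qjacobiE (F : fieldType) (q : F) n (a b : F) :
  little_qjacobi q n a b = \sum_(j < n.+1) lqj_coef q n a b j *: 'X^j.
Proof. by apply: eq_bigr => j _; rewrite exprZn scalerA. Qed.

(** The q-difference operator having the little q-Jacobi polynomials as
eigenfunctions maps X^j to lqj_diag j X^j - lqj_offdiag j X^(j-1); being
triangular, it has the eigenvalues lqj_diag n. *)
Definition lqj_diag (F : fieldType) (q a b : F) (j : nat) : F :=
  (q ^- j - 1) * (1 - a * b * q ^+ j.+1).

Definition lqj_offdiag (F : fieldType) (q a : F) (j : nat) : F :=
  (q ^- j - 1) * (1 - a * q ^+ j).

(** The eigenvalue equation of the q-difference operator, read on the
coefficient of X^j. *)
Lemma lqj_coef_rec (F : fieldType) (q a b : F) n j : q != 0 ->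
  (forall i, 1 - q ^+ i.+1 != 0) -> (forall i, 1 - a * q ^+ i.+1 != 0) ->
  (lqj_diag q a b j - lqj_diag q a b n) * lqj_coef q n a b j =
  lqj_offdiag q a j.+1 * lqj_coef q n a b j.+1.
Proof.
move=> q0 hq haq; rewrite /lqj_coef !qpochhammerS /lqj_diag /lqj_offdiag.
have h1 : qpochhammer (a * q) q j != 0.
  by apply: qpochhammer_neq0 => i _; rewrite -mulrA -exprS.
have h2 : qpochhammer q q j != 0.
  by apply: qpochhammer_neq0 => i _; rewrite -exprS.
have := hq j; have := haq j; rewrite !exprS => h3 h4.
have uj : q ^+ j != 0 by rewrite expf_neq0.
have un : q ^+ n != 0 by rewrite expf_neq0.
by field; rewrite h1 h2 q0 uj un h4 -mulrA h3.
Qed.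

Lemma lqj_coef_oversize (F : fieldType) (q a b : F) n : q != 0 ->
  lqj_coef q n a b n.+1 = 0.
Proof.
move=> q0; rewrite /lqj_coef qpochhammerS mulVf ?expf_neq0//.
by rewrite subrr mulr0 !mul0r.
Qed.

(** Up to normalisation, the moments of the measure are
(aq;q)_m / (abq^2;q)_m. *)
Definition lqj_moments (F : fieldType) (q a b : F) (mu : nat -> F) :=
  forall m, (1 - a * b * q ^+ m.+2) * mu m.+1 = (1 - a * q ^+ m.+1) * mu m.

Lemma lqj_diagB (F : fieldType) (q a b : F) i j : q != 0 ->
  lqj_diag q a b i - lqj_diag q a b j =
  (q ^- i - q ^- j) * (1 - a * b * q ^+ (i + j).+1).
Proof.
move=> q0; have ui : q ^+ i != 0 by rewrite expf_neq0.
have uj : q ^+ j != 0 by rewrite expf_neq0.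
by rewrite /lqj_diag !exprS exprD; field; rewrite ui uj.
Qed.

(** The q-difference operator is symmetric for the bilinear form
(X^i, X^j) |-> mu (i + j).  For i = j = 0 the truncated predecessor is
harmless, since both differences vanish. *)
Lemma lqj_moments_symmetric (F : fieldType) (q a b : F) mu i j : q != 0 ->
  lqj_moments q a b mu ->
  (lqj_diag q a b i - lqj_diag q a b j) * mu (i + j)%N =
  (lqj_offdiag q a i - lqj_offdiag q a j) * mu (i + j).-1.
Proof.
move=> q0 hmu; have ui : q ^+ i != 0 by rewrite expf_neq0.
have uj : q ^+ j != 0 by rewrite expf_neq0.
rewrite lqj_diagB//.
have -> : lqj_offdiag q a i - lqj_offdiag q a j =
    (q ^- i - q ^- j) * (1 - a * q ^+ (i + j)).
  by rewrite /lqj_offdiag exprD; field; rewrite ui uj.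
rewrite -[LHS]mulrA -[RHS]mulrA; case E : (i + j)%N => [|m] /=; last by rewrite hmu.
by move/eqP: E; rewrite addn_eq0 => /andP[/eqP-> /eqP->]; rewrite subrr !mul0r.
Qed.

(** The eigenvalue equation and the symmetry of the operator give
(e_n - e_m) L(p X^m) = - d_m L(p X^(m-1)) for the eigenvalues e and the
off-diagonal entries d; as d_0 = 0 and e_n <> e_m for m < n, L(p X^m) vanishes
by induction on m. *)
Lemma little_qjacobi_orthogonal (F : fieldType) (q a b : F) mu n : q != 0 ->
  (forall i, 1 - q ^+ i.+1 != 0) -> (forall i, 1 - a * q ^+ i.+1 != 0) ->
  (forall i, 1 - a * b * q ^+ i.+2 != 0) ->
  lqj_moments q a b mu ->
  orthogonal_to_lower (moment_functional mu) n (little_qjacobi q n a b).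
Proof.
move=> q0 hq haq habq hmu.
pose e := lqj_diag q a b; pose d := lqj_offdiag q a.
pose c := lqj_coef q n a b.
pose M m := \sum_(j < n.+1) c j * mu (j + m)%N.
have MX m : moment_functional mu (little_qjacobi q n a b * 'X^m) = M m.
  rewrite little_qjacobiE mulr_suml linear_sum; apply: eq_bigr => j _ /=.
  by rewrite -scalerAl -exprD linearZ/= moment_functionalXn.
have d0 : d 0%N = 0 by rewrite /d /lqj_offdiag expr0 invr1 subrr mul0r.
have step m : (e n - e m) * M m = - d m * \sum_(j < n.+1) c j * mu (j + m).-1.
  (* The terms of the two sums differ by decrements of G, which vanishes at
     both ends: d_0 = 0 and c_(n+1) = 0. *)
  pose G j := d j * c j * mu (j + m).-1.
  have -> : - d m * (\sum_(j < n.+1) c j * mu (j + m).-1) =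
     - d m * (\sum_(j < n.+1) c j * mu (j + m).-1) -
     \sum_(0 <= j < n.+1) (G j.+1 - G j).
    rewrite telescope_sumr// /G /c lqj_coef_oversize// d0.
    by rewrite !(mulr0, mul0r) subrr subr0.
  rewrite big_mkord /M !mulr_sumr -sumrB; apply: eq_bigr => j _.
  have H1 : (e j - e n) * c j = d j.+1 * c j.+1 by exact: lqj_coef_rec.
  have H2 := lqj_moments_symmetric j m q0 hmu.
  rewrite /G addSn/= -H1; move: H2; rewrite -/(e _) -/(e _) -/(d _) -/(d _) => H2.
  have -> : (e n - e m) * (c j * mu (j + m)%N) =
     c j * ((e j - e m) * mu (j + m)%N) - (e j - e n) * c j * mu (j + m)%N.
    by ring.
  by rewrite H2; ring.
have eNm m : (m < n)%N -> e n - e m != 0.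
  move=> mn; rewrite /e lqj_diagB// mulf_neq0//; last first.
    by rewrite -(subnKC mn) addSn; apply: habq.
  rewrite -(subnKC mn) addSnnS exprD invfM.
  have -> : q ^- m / q ^+ (n - m.+1).+1 - q ^- m =
     q ^- m / q ^+ (n - m.+1).+1 * (1 - q ^+ (n - m.+1).+1).
    by rewrite mulrBr mulr1 divfK ?expf_neq0.
  by rewrite !mulf_neq0 ?invr_neq0 ?expf_neq0.
have M0 m : (m < n)%N -> M m = 0.
  move=> mn; apply: (mulfI (eNm m mn)); rewrite step mulr0.
  elim: m mn => [|m IH] mn; first by rewrite d0 oppr0 mul0r.
  under eq_bigr do rewrite addnS.
  have Mm : (e n - e m) * M m = (e n - e m) * 0.
    by rewrite step IH ?mulr0// ltnW.
  by rewrite [X in _ * X](mulfI (eNm _ (ltnW mn)) Mm) mulr0.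
move=> r sr; rewrite -[r]coefK poly_def mulr_sumr linear_sum big1// => i _ /=.
rewrite -scalerAr linearZ/= MX M0 ?mulr0//.
exact: leq_trans (ltn_ord i) sr.
Qed.

(** * Discrete measures on the q-grid *)

Definition qgrid_moment (R : realType) (q : R) (w : nat -> R) (m : nat) : R :=
  limn (series (fun k => w k * q ^+ k ^+ m)).

Lemma cvg_qgrid_moment (R : realType) (q : R) (w : nat -> R) m :
  0 < q < 1 -> (forall k, 0 < w k) -> cvgn (series w) ->
  series (fun k => w k * q ^+ k ^+ m) @ \oo --> qgrid_moment q w m.
Proof.
move=> /andP[q0 q1] w0 cw; apply: (series_le_cvg _ _ _ cw) => k.
- by rewrite mulr_ge0 ?exprn_ge0// ltW.
- exact: ltW.
- rewrite ler_piMr ?(ltW (w0 _))// -exprM; by apply: exprn_ile1; rewrite ?ltW.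
Qed.

Lemma cvg_qgrid_functional (R : realType) (q : R) (w : nat -> R) (h : {poly R}) :
  0 < q < 1 -> (forall k, 0 < w k) -> cvgn (series w) ->
  series (fun k => w k * h.[q ^+ k]) @ \oo -->
    moment_functional (qgrid_moment q w) h.
Proof.
move=> q01 w0 cw.
have -> : series (fun k => w k * h.[q ^+ k]) =
    fun N => \sum_(i < size h) h`_i * series (fun k => w k * q ^+ k ^+ i) N.
  apply/funext => N; rewrite /series/=.
  under [RHS]eq_bigr do rewrite mulr_sumr.
  rewrite exchange_big/=; apply: eq_bigr => k _; rewrite horner_coef mulr_sumr.
  by apply: eq_bigr => i _; ring.
rewrite /moment_functional.
apply: (cvg_big (op := +%R) (x0 := 0)); [exact: add_continuous|move=> i _].
by apply: cvgM; [exact: cvg_cst|exact: cvg_qgrid_moment].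
Qed.

Lemma limit_series_gt0 (R : realType) (f : nat -> R) (l : R) :
  series f @ \oo --> l -> (forall k, 0 <= f k) -> (exists k, 0 < f k) -> 0 < l.
Proof.
move=> fl f0 [k fk].
have nd : nondecreasing_seq (series f).
  by apply: (@nondecreasing_series _ f xpredT 0%N) => n _ _.
rewrite -(cvg_lim _ fl)//; apply: lt_le_trans (nondecreasing_cvgn_le nd _ k.+1).
  rewrite /series/= big_nat_recr//= ltr_wpDl// sumr_ge0//.
by apply/cvg_ex; exists l.
Qed.

Lemma qgrid_injective (R : realType) (q : R) : 0 < q < 1 ->
  injective (fun k => q ^+ k).
Proof.
by move=> /andP[q0 q1]; apply: ieexprIn; rewrite ?lt_eqF.
Qed.

Lemma qgrid_nonroot (R : realType) (q : R) (p : {poly R}) : 0 < q < 1 ->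
  p != 0 -> exists k, ~~ root p (q ^+ k).
Proof.
move=> q01 p0; apply/not_existsP => allroot.
pose s := [seq q ^+ k | k <- iota 0 (size p)].
have : (size s < size p)%N.
  apply: max_poly_roots => //.
    by apply/allP => x /mapP[k _ ->]; have /negP := allroot k; rewrite negbK.
  by rewrite map_inj_uniq ?iota_uniq//; exact: qgrid_injective.
by rewrite size_map size_iota ltnn.
Qed.

Lemma qgrid_functional_positive (R : realType) (q : R) (w : nat -> R) :
  0 < q < 1 -> (forall k, 0 < w k) -> cvgn (series w) ->
  positive_on_unit_interval (moment_functional (qgrid_moment q w)).
Proof.
move=> q01 w0 cw h h0 hge.
have /andP[q0 q1] := q01.
have grid k : 0 <= q ^+ k <= 1.
  rewrite exprn_ge0 ?(ltW q0)//=; by apply: exprn_ile1; rewrite ?ltW.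
apply: (limit_series_gt0 (cvg_qgrid_functional q01 w0 cw)) => [k|].
  by rewrite mulr_ge0 ?hge// ltW.
have [k rk] := qgrid_nonroot q01 h0; exists k.
by rewrite mulr_gt0// lt_neqAle eq_sym rk hge.
Qed.

Lemma expr_eventually_lt (R : realType) (q t : R) : 0 < q < 1 -> 0 < t ->
  exists m, q ^+ m <= t.
Proof.
move=> /andP[q0 q1] t0; have := @cvg_expr R q; rewrite gtr0_norm// => /(_ q1).
move=> /cvgr_le /(_ t t0) [m _ /(_ m (leqnn m)) h]; by exists m.
Qed.

(** The constant c is the ratio of the weights at q^m, the largest node not
exceeding t: the two factors w2_k - c w1_k and q^k - t then change sign at the
same place. *)
Lemma qgrid_functional_dominates (R : realType) (q : R) (w1 w2 : nat -> R) (t : R) :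
  0 < q < 1 -> (forall k, 0 < w1 k) -> (forall k, 0 < w2 k) ->
  cvgn (series w1) -> cvgn (series w2) ->
  (forall k, w2 k.+1 / w1 k.+1 < w2 k / w1 k) -> 0 < t ->
  exists2 c : R, 0 <= c & forall p : {poly R}, p != 0 ->
    c * moment_functional (qgrid_moment q w1) (('X - t%:P) * p ^+ 2) <
        moment_functional (qgrid_moment q w2) (('X - t%:P) * p ^+ 2).
Proof.
move=> q01 w10 w20 cw1 cw2 ratio t0; have /andP[q0 q1] := q01.
have ex := expr_eventually_lt q01 t0; pose m := ex_minn ex.
have mt : q ^+ m <= t by rewrite /m; case: ex_minnP.
have ltm k : (k < m)%N -> t < q ^+ k.
  rewrite /m; case: ex_minnP => i _ mini ki; rewrite ltNge; apply/negP => /mini.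
  by rewrite leqNgt ki.
pose f k := w2 k / w1 k; pose c := f m.
have fdec i j : (i < j)%N -> f j < f i.
  elim: j => // j IH; rewrite ltnS leq_eqVlt => /predU1P[->|/IH]; first exact: ratio.
  exact/lt_trans/ratio.
exists c; first by rewrite /c /f divr_ge0// ltW.
move=> p p0; set g := ('X - t%:P) * p ^+ 2.
rewrite -subr_gt0.
have lim : series (fun k => (w2 k - c * w1 k) * g.[q ^+ k]) @ \oo -->
    moment_functional (qgrid_moment q w2) g -
    c * moment_functional (qgrid_moment q w1) g.
  rewrite (_ : series _ = fun N => series (fun k => w2 k * g.[q ^+ k]) N -
                              c * series (fun k => w1 k * g.[q ^+ k]) N); last first.
    apply/funext => N; rewrite /series/= mulr_sumr -sumrB.
    by apply: eq_bigr => k _; ring.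
  apply: cvgB; first exact: cvg_qgrid_functional.
  by apply: cvgM; [exact: cvg_cst|exact: cvg_qgrid_functional].
have wE k : w2 k - c * w1 k = w1 k * (f k - c).
  by rewrite /f mulrBr [w1 k * (_ / _)]mulrC divfK ?gt_eqF// mulrC.
have pos k : k != m -> 0 < (w2 k - c * w1 k) * (q ^+ k - t).
  rewrite wE -mulrA neq_ltn => /orP[km|mk].
    by rewrite !mulr_gt0// subr_gt0 ?ltm// fdec.
  rewrite pmulr_rgt0// nmulr_rgt0 ?subr_lt0 ?fdec//.
  by apply: lt_le_trans mt; rewrite ltr_iXn2l.
have gE x : g.[x] = (x - t) * p.[x] ^+ 2.
  by rewrite hornerM horner_exp hornerXsubC.
apply: (limit_series_gt0 lim) => [k|].
  rewrite gE mulrA; have [->|km] := eqVneq k m.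
    by rewrite wE /c subrr mulr0 !mul0r.
  by rewrite mulr_ge0 ?sqr_ge0// ltW// pos.
(* The extra factor provides a node that is neither a zero of p nor q^m, the
   only node at which the product of the two factors may vanish. *)
have := @qgrid_nonroot _ q (p * ('X - (q ^+ m)%:P)) q01.
rewrite mulf_neq0 ?polyXsubC_eq0// => /(_ isT)[k]; rewrite rootM negb_or root_XsubC.
move=> /andP[rk km]; exists k; rewrite gE mulrA mulr_gt0 ?pos//.
  by apply: contraNneq km => ->.
by rewrite exprn_even_gt0.
Qed.

(** * The weights of the little q-Jacobi polynomials *)

Definition lqj_weight (F : fieldType) (q a b : F) (k : nat) : F :=
  qpochhammer (b * q) q k / qpochhammer q q k * (a * q) ^+ k.

Lemma onem_mul_expr_gt0 (R : realFieldType) (q c : R) i :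
  0 < q < 1 -> c < 1 -> 0 < 1 - c * q ^+ i.
Proof.
move=> /andP[q0 q1] c1; rewrite subr_gt0.
have qi0 : 0 < q ^+ i by rewrite exprn_gt0.
have qi1 : q ^+ i <= 1 by apply: exprn_ile1; rewrite ltW.
have [c0|c0] := leP c 0; first by rewrite (le_lt_trans _ ltr01)// pmulr_lle0.
by apply: le_lt_trans c1; rewrite ler_piMr// ltW.
Qed.

Lemma onem_mul_exprS_gt0 (R : realFieldType) (q c : R) i :
  0 < q < 1 -> c * q < 1 -> 0 < 1 - c * q ^+ i.+1.
Proof. by move=> q01 cq; rewrite exprS mulrA onem_mul_expr_gt0. Qed.

Lemma onem_mul2_exprSS_gt0 (R : realFieldType) (q a b : R) i :
  0 < q < 1 -> 0 < a * q < 1 -> b * q < 1 -> 0 < 1 - a * b * q ^+ i.+2.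
Proof.
move=> q01 /andP[a0 a1] b1; rewrite exprS mulrA onem_mul_exprS_gt0//.
have -> : a * b * q * q = (a * q) * (b * q) by ring.
have [b0|b0] := leP (b * q) 0.
  by rewrite (le_lt_trans _ ltr01)// pmulr_rle0.
by rewrite mulr_ilt1// ltW.
Qed.

Lemma lqj_weight_gt0 (R : realFieldType) (q a b : R) k :
  0 < q < 1 -> 0 < a * q -> b * q < 1 -> 0 < lqj_weight q a b k.
Proof.
move=> q01 a0 b1; have /andP[_ q1] := q01.
rewrite /lqj_weight mulr_gt0 ?exprn_gt0// divr_gt0// /qpochhammer prodr_gt0//.
  by move=> i _; apply: onem_mul_expr_gt0.
by move=> i _; apply: onem_mul_expr_gt0.
Qed.

(** The discrete Pearson equation of the weights, the source of the
recurrence of the moments and of the convergence of their sums. *)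
Lemma lqj_weight_pearson (F : fieldType) (q a b : F) k : 1 - q ^+ k.+1 != 0 ->
  lqj_weight q a b k.+1 * (1 - q ^+ k.+1) =
  lqj_weight q a b k * (a * q * (1 - b * q ^+ k.+1)).
Proof.
rewrite /lqj_weight !qpochhammerS !exprS => h; rewrite invfM.
transitivity (lqj_weight q a b k * (a * q * (1 - b * (q * q ^+ k))) *
  ((1 - q * q ^+ k)^-1 * (1 - q * q ^+ k))); rewrite /lqj_weight; first by ring.
by rewrite mulVf// mulr1.
Qed.

(** The quantity whose decrements are the terms of the moment recurrence; it
vanishes at k = 0 because of the factor 1 - q^k. *)
Definition lqj_flux (F : fieldType) (q a b : F) m k : F :=
  lqj_weight q a b k * q ^+ k ^+ m * (1 - q ^+ k).

Lemma lqj_flux_telescope (F : fieldType) (q a b : F) m k : 1 - q ^+ k.+1 != 0 ->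
  lqj_flux q a b m k - lqj_flux q a b m k.+1 =
  (1 - a * q ^+ m.+1) * (lqj_weight q a b k * q ^+ k ^+ m) -
  (1 - a * b * q ^+ m.+2) * (lqj_weight q a b k * q ^+ k ^+ m.+1).
Proof.
move=> h; rewrite /lqj_flux -[in X in _ - X]mulrA [q ^+ k.+1 ^+ m * _]mulrC.
rewrite mulrA lqj_weight_pearson//.
by rewrite !exprS exprMn; ring.
Qed.

(** For m = 0 the decrement of the flux is w_k ((1 - aq) - (1 - abq^2) q^k).
As soon as (1 - abq^2) q^k <= (1 - aq) / 2, it exceeds w_k (1 - aq) / 2, so the
tail of the series of weights is bounded by a telescoping sum. *)
Lemma cvg_series_lqj_weight (R : realType) (q a b : R) :
  0 < q < 1 -> 0 < a * q < 1 -> b * q < 1 ->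
  cvgn (series (lqj_weight q a b)).
Proof.
move=> q01 a01 b1; have /andP[q0 q1] := q01; have /andP[a0 a1] := a01.
have qk k : 1 - q ^+ k.+1 != 0.
  by have := @onem_mul_exprS_gt0 _ q 1 k q01; rewrite !mul1r => /(_ q1)/gt_eqF->.
have w0 k := lqj_weight_gt0 k q01 a0 b1.
have ab0 : 0 < 1 - a * b * q ^+ 2.
  exact: onem_mul2_exprSS_gt0.
set ab := 1 - a * b * q ^+ 2 in ab0 *.
have [|M hM] := @expr_eventually_lt R q ((1 - a * q) / (2 * ab)) q01.
  by rewrite divr_gt0 ?mulr_gt0// subr_gt0.
have flux_ge0 k : 0 <= lqj_flux q a b 0 k.
  rewrite /lqj_flux mulr_ge0 ?subr_ge0//; first by rewrite expr0 mulr1 ltW.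
  by apply: exprn_ile1; rewrite ltW.
have tail N : series (lqj_weight q a b) (M + N)%N <=
    series (lqj_weight q a b) M + 2 / (1 - a * q) *
      (lqj_flux q a b 0 M - lqj_flux q a b 0 (M + N)%N).
  elim: N => [|N IH]; first by rewrite addn0 subrr mulr0 addr0.
  rewrite addnS seriesSr/=.
  have := lqj_flux_telescope a b 0 (qk (M + N)%N).
  have qMN : q ^+ (M + N) <= (1 - a * q) / (2 * ab).
    apply: le_trans hM; rewrite exprD ler_piMr ?exprn_ge0 ?(ltW q0)//.
    by apply: exprn_ile1; rewrite ltW.
  rewrite -/ab expr0 mulr1 !expr1 => fluxE.
  set w := lqj_weight q a b in w0 IH fluxE *; set n := (M + N)%N in IH qMN fluxE *.
  have da : 0 < 1 - a * q by rewrite subr_gt0.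
  have : ab * q ^+ n <= (1 - a * q) / 2.
    by move: qMN; rewrite invfM mulrA ler_pdivlMr// mulrC.
  move=> /(ler_wpM2l (ltW (w0 n))) half.
  have incr : w n <= 2 / (1 - a * q) *
      (lqj_flux q a b 0 n - lqj_flux q a b 0 n.+1).
    by rewrite fluxE mulrAC ler_pdivlMr//; move: half; lra.
  have := lerD IH incr; rewrite -addrA -mulrDr.
  rewrite (_ : _ + (_ - lqj_flux q a b 0 n.+1) =
    lqj_flux q a b 0 M - lqj_flux q a b 0 n.+1); last by ring.
  by rewrite addrC.
have nd : nondecreasing_seq (series (lqj_weight q a b)).
  by apply: (@nondecreasing_series _ _ xpredT 0%N) => n _ _; exact: ltW.
apply: nondecreasing_is_cvgn => //.
exists (series (lqj_weight q a b) M + 2 / (1 - a * q) * lqj_flux q a b 0 M).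
move=> _ [N _ <-]; apply: le_trans (nd _ _ (leq_addl M N)) _.
apply: le_trans (tail N) _; rewrite lerD2l ler_wpM2l// ?lerBlDr ?lerDl//.
by rewrite divr_ge0// subr_ge0 ltW.
Qed.

(** Summing the decrements of the flux over all k gives 0: the flux starts
at 0 and tends to 0. *)
Lemma qgrid_moments_lqj_weight (R : realType) (q a b : R) :
  0 < q < 1 -> 0 < a * q < 1 -> b * q < 1 ->
  lqj_moments q a b (qgrid_moment q (lqj_weight q a b)).
Proof.
move=> q01 a01 b1 m; have /andP[q0 q1] := q01; have /andP[a0 a1] := a01.
have qk k : 1 - q ^+ k.+1 != 0.
  by have := @onem_mul_exprS_gt0 _ q 1 k q01; rewrite !mul1r => /(_ q1)/gt_eqF->.
have w0 k := lqj_weight_gt0 k q01 a0 b1.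
have cw := cvg_series_lqj_weight q01 a01 b1.
have cm i := cvg_qgrid_moment (m := i) q01 w0 cw.
have flux0 : lqj_flux q a b m @ \oo --> (0 : R).
  rewrite (_ : lqj_flux q a b m = fun k => lqj_weight q a b k * q ^+ k ^+ m -
      lqj_weight q a b k * q ^+ k ^+ m.+1).
    by rewrite -(subr0 0); apply: cvgB; apply: cvg_series_cvg_0;
      apply/cvg_ex; eexists; exact: cm.
  by apply/funext => k; rewrite /lqj_flux exprSr; ring.
have lim : (fun N => - lqj_flux q a b m N) @ \oo -->
    (1 - a * q ^+ m.+1) * qgrid_moment q (lqj_weight q a b) m -
    (1 - a * b * q ^+ m.+2) * qgrid_moment q (lqj_weight q a b) m.+1.
  rewrite (_ : (fun N => - _) = fun N =>
    (1 - a * q ^+ m.+1) *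
      series (fun k => lqj_weight q a b k * q ^+ k ^+ m) N -
    (1 - a * b * q ^+ m.+2) *
      series (fun k => lqj_weight q a b k * q ^+ k ^+ m.+1) N).
    by apply: cvgB; (apply: cvgM; [exact: cvg_cst|exact: cm]).
  apply/funext => N; rewrite /series/= !mulr_sumr -sumrB.
  under [RHS]eq_bigr do rewrite -lqj_flux_telescope// -opprB.
  have flux00 : lqj_flux q a b m 0 = 0 by rewrite /lqj_flux expr0 subrr mulr0.
  by rewrite sumrN telescope_sumr// flux00 subr0.
apply/eqP; rewrite eq_sym -subr_eq0 -(cvg_lim _ lim)//; apply/eqP/cvg_lim => //.
by rewrite -oppr0; apply: cvgN.
Qed.

(** * Zeros of the little q-Jacobi polynomials *)

Lemma little_qjacobi_size (F : fieldType) (q : F) n (a b : F) :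
  (size (little_qjacobi q n a b) <= n.+1)%N.
Proof.
rewrite little_qjacobiE -(poly_def n.+1); exact: size_poly.
Qed.

Lemma little_qjacobi_neq0 (F : fieldType) (q : F) n (a b : F) :
  little_qjacobi q n a b != 0.
Proof.
apply/eqP => /(congr1 (fun p : {poly F} => p`_0)).
rewrite little_qjacobiE -(poly_def n.+1) coef_poly coef0 /lqj_coef /qpochhammer.
rewrite /= !big_ord0 expr0 !mulr1 divr1; exact/eqP/oner_neq0.
Qed.

Definition lqj_functional (R : realType) (q a b : R) : {scalar {poly R}} :=
  moment_functional (qgrid_moment q (lqj_weight q a b)).

Lemma lqj_functional_positive (R : realType) (q a b : R) :
  0 < q < 1 -> 0 < a * q < 1 -> b * q < 1 ->
  positive_on_unit_interval (lqj_functional q a b).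
Proof.
move=> q01 a01 b1; have /andP[a0 _] := a01; apply: qgrid_functional_positive => //.
  by move=> k; exact: lqj_weight_gt0.
exact: cvg_series_lqj_weight.
Qed.

Lemma lqj_functional_orthogonal (R : realType) (q a b : R) n :
  0 < q < 1 -> 0 < a * q < 1 -> b * q < 1 ->
  orthogonal_to_lower (lqj_functional q a b) n (little_qjacobi q n a b).
Proof.
move=> q01 a01 b1; have /andP[q0 q1] := q01; have /andP[a0 a1] := a01.
apply: little_qjacobi_orthogonal.
- by rewrite gt_eqF.
- by move=> i; rewrite -[q ^+ _]mul1r gt_eqF// onem_mul_exprS_gt0// mul1r.
- by move=> i; rewrite gt_eqF// onem_mul_exprS_gt0.
- by move=> i; rewrite gt_eqF// onem_mul2_exprSS_gt0.
- exact: qgrid_moments_lqj_weight.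
Qed.

Lemma little_qjacobi_roots (R : realType) (q a b : R) n :
  0 < q < 1 -> 0 < a * q < 1 -> b * q < 1 ->
  let s := little_qjacobi_zeros q n a b in
  size s = n /\ little_qjacobi q n a b =
    lead_coef (little_qjacobi q n a b) *: prod_roots s.
Proof.
move=> q01 a01 b1; apply: (orthogonal_roots (L := lqj_functional q a b)).
- exact: lqj_functional_positive.
- exact: little_qjacobi_neq0.
- exact: little_qjacobi_size.
- exact: lqj_functional_orthogonal.
Qed.

Lemma prod_zeros_orthogonal (R : realType) (q a b : R) n :
  0 < q < 1 -> 0 < a * q < 1 -> b * q < 1 ->
  orthogonal_to_lower (lqj_functional q a b) n
    (prod_roots (little_qjacobi_zeros q n a b)).
Proof.
move=> q01 a01 b1 r rn; have [_ pE] := little_qjacobi_roots n q01 a01 b1.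
have := lqj_functional_orthogonal q01 a01 b1 rn.
rewrite {1}pE -scalerAl linearZ/= => /eqP; rewrite mulf_eq0 lead_coef_eq0.
by rewrite (negPf (little_qjacobi_neq0 _ _ _ _)) => /eqP.
Qed.

Lemma mup_little_qjacobi (R : realType) (q a b : R) n x :
  0 < q < 1 -> 0 < a * q < 1 -> b * q < 1 ->
  x \in little_qjacobi_zeros q n a b -> mup x (little_qjacobi q n a b) = 1%N.
Proof.
move=> q01 a01 b1 xs; have [_ ->] := little_qjacobi_roots n q01 a01 b1.
rewrite -mul_polyC mupMr ?rootC ?lead_coef_eq0 ?little_qjacobi_neq0//.
by rewrite /prod_roots mu_prod_XsubC count_uniq_mem ?xs// uniq_roots.
Qed.

(** By the Pearson equation, w2_k / w1_k decreases in k as soon as the growth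
factors of w2 are smaller than those of w1; the common factor q / (1 - q^(i+1))
of these growth factors is left out of the hypothesis. *)
Lemma little_qjacobi_zero_lt (R : realType) (q a1 b1 a2 b2 : R) n k :
  0 < q < 1 -> 0 < a1 * q < 1 -> b1 * q < 1 -> 0 < a2 * q < 1 -> b2 * q < 1 ->
  (k < n)%N ->
  (forall i, a2 * (1 - b2 * q ^+ i.+1) < a1 * (1 - b1 * q ^+ i.+1)) ->
  little_qjacobi_zero q n k a1 b1 < little_qjacobi_zero q n k a2 b2.
Proof.
move=> q01 ha1 hb1 ha2 hb2 kn ratio.
have [sz1 _] := little_qjacobi_roots n q01 ha1 hb1.
have [sz2 _] := little_qjacobi_roots n q01 ha2 hb2.
have [a10 a20] : 0 < a1 * q /\ 0 < a2 * q by move: ha1 ha2; lra.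
have w10 i := lqj_weight_gt0 i q01 a10 hb1.
have w20 i := lqj_weight_gt0 i q01 a20 hb2.
have cw1 := cvg_series_lqj_weight q01 ha1 hb1.
have cw2 := cvg_series_lqj_weight q01 ha2 hb2.
have /andP[q0 q1] := q01.
have ratioS i : lqj_weight q a2 b2 i.+1 / lqj_weight q a1 b1 i.+1 <
                lqj_weight q a2 b2 i / lqj_weight q a1 b1 i.
  have Q0 : 0 < 1 - q ^+ i.+1.
    by rewrite -[q ^+ _]mul1r onem_mul_exprS_gt0// mul1r.
  have B1 : 0 < a1 * q * (1 - b1 * q ^+ i.+1).
    by rewrite mulr_gt0// onem_mul_exprS_gt0.
  rewrite ltr_pdivrMr// mulrAC ltr_pdivlMr// -(ltr_pM2r Q0).
  have P1 := lqj_weight_pearson a1 b1 (lt0r_neq0 Q0).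
  have P2 := lqj_weight_pearson a2 b2 (lt0r_neq0 Q0).
  rewrite [X in X < _]mulrAC P2 -[X in _ < X]mulrA P1.
  rewrite -[X in X < _]mulrA ltr_pM2l// mulrC ltr_pM2l//.
  by rewrite ![_ * q * _]mulrAC ltr_pM2r.
have t0 : 0 < (little_qjacobi_zeros q n a1 b1)`_k.
  have := mem_nth 0 (s := little_qjacobi_zeros q n a1 b1) (n := k).
  by rewrite sz1 => /(_ kn); rewrite in_roots in_itv/= => /and3P[_ /andP[]].
have [c c0 dom] := qgrid_functional_dominates q01 w10 w20 cw1 cw2 ratioS t0.
apply: (@markov_zeros_lt _ (lqj_functional q a1 b1) (lqj_functional q a2 b2)
  _ _ k c) => //; try exact: sorted_roots.
- by rewrite sz1 sz2.
- by rewrite sz1.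
- by rewrite sz1; exact: prod_zeros_orthogonal.
- by rewrite sz2; exact: prod_zeros_orthogonal.
- exact/positive_sqr_ge0/lqj_functional_positive.
- exact/positive_sqr_ge0/lqj_functional_positive.
Qed.

Unset Implicit Arguments.

Theorem theorem3p1 (R : realType) (q : R) (n : nat)
    (hq : 0 < q < 1) (hn : (1 <= n)%N) :
  (forall a b : R, 0 < a * q < 1 -> b * q < 1 ->
     size (little_qjacobi_zeros q n a b) = n /\
     (forall x : R, x \in little_qjacobi_zeros q n a b ->
        mup x (little_qjacobi q n a b) = 1%N)) /\
  (forall k : 'I_n,
     (forall a : R, 0 < a < 1 / q ->
        forall b1 b2 : R, b1 < 1 / q -> b2 < 1 / q -> b1 < b2 ->
          little_qjacobi_zero q n k a b1 < little_qjacobi_zero q n k a b2) /\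
     (forall b : R, b < 1 / q ->
        forall a1 a2 : R, 0 < a1 < 1 / q -> 0 < a2 < 1 / q -> a1 < a2 ->
          little_qjacobi_zero q n k a2 b < little_qjacobi_zero q n k a1 b)).
Proof.
have /andP[q0 q1] := hq.
have ltq c : c < 1 / q -> c * q < 1 by rewrite ltr_pdivlMr.
have aq a : 0 < a < 1 / q -> 0 < a * q < 1.
  by move=> /andP[a0 /ltq ->]; rewrite mulr_gt0.
split=> [a b a01 b1|k].
  split; first by have [] := little_qjacobi_roots n hq a01 b1.
  by move=> x; exact: mup_little_qjacobi.
split=> [a ha b1 b2 hb1 hb2 b12|b hb a1 a2 ha1 ha2 a12].
  apply: little_qjacobi_zero_lt; rewrite ?aq ?ltq// => i.
  by rewrite ltr_pM2l ?ltrD2l ?ltrN2 ?ltr_pM2r ?exprn_gt0//; case/andP: ha.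
apply: little_qjacobi_zero_lt; rewrite ?aq ?ltq// => i.
by rewrite ltr_pM2r// onem_mul_exprS_gt0 ?ltq.
Qed.
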